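(* Let $\Bbbk$ be a commutative ring and let $\pi_\infty:B^{-1}_{\infty,2}\to M_\infty$ be the unique morphism of Baxter algebras (algebra morphism with $\pi_\infty\beta_{\infty,2}=\beta_\infty\pi_\infty$) such that $\pi_\infty(Y)=x_0$. Let $t\in\mathcal T_{\infty,2}$, let $t_1,\dots,t_n\in\widehat{\mathcal T}^+_{\infty,2}$ be the subtrees of $t$ rooted at the children of the root (left to right), and let $i_1,\dots,i_{n-1}$ be the labels of the angles between consecutive such children. Then $$\pi_\infty(t)=\begin{cases}x_1^{\deg_{\mathrm{angle}}(t_1)}\,x_0^{i_1}\,x_1^{\deg_{\mathrm{angle}}(t_2)}\cdots x_0^{i_{n-1}}\,x_1^{\deg_{\mathrm{angle}}(t_n)}&\text{if }t\in\mathcal T^0_{\infty,2},\\ x_1^{\deg_{\mathrm{angle}}(t)}&\text{if }t\in\mathcal T^+_{\infty,2}.\end{cases}$$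
   Context: All algebras are associative $\Bbbk$-algebras, not necessarily unital. A Baxter algebra of weight $\lambda$ is a pair $(A,\beta)$ with $A$ an algebra and $\beta:A\to A$ linear with $\beta(a)\beta(b)=\beta(\beta(a)b+a\beta(b)+\lambda ab)$. \textbf{The algebra $M_\infty$.} $M_\infty=\Bbbk\langle x_0,x_1\rangle$ is the free non-unital associative algebra on $x_0,x_1$, and $\beta_\infty:M_\infty\to M_\infty$ is the algebra morphism with $\beta_\infty(x_0)=\beta_\infty(x_1)=x_1$. It is an idempotent morphism of algebras, hence an idempotent Baxter operator of weight $-1$. A factor $x_1^0$ is understood to be omitted. \textbf{Decorated trees.} In a rooted planar tree, a node is a leaf if it has no children and internal otherwise; an angle is the sector between two consecutive children of an internal node. $\mathcal T_{\infty,2}$ is the set of finite rooted planar trees with at least one internal node, with each angle labeled by a positive integer and each internal node labeled by $0$ or $1$, such that: every internal node has at least two children; among the children of each node only the leftmost and rightmost can be leaves; only the root may have label $0$. $\mathcal T^+_{\infty,2}$ (resp. $\mathcal T^0_{\infty,2}$) is the subset of trees with root label $1$ (resp. $0$). $\bullet$ is the unlabeled tree with a single node; $\widehat{\mathcal T}_{\infty,2}=\mathcal T_{\infty,2}\cup\{\bullet\}$, $\widehat{\mathcal T}^+_{\infty,2}=\mathcal T^+_{\infty,2}\cup\{\bullet\}$. $\deg_{\mathrm{angle}}(t)$ is the sum of the angle labels of $t$, and $\deg_{\mathrm{angle}}(\bullet)=0$. $Y$ is the tree with a single internal node (the root, labeled $0$) having two children, both leaves, with angle label $1$. \textbf{The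 Baxter algebra $B^{-1}_{\infty,2}$ (weight $\lambda=-1$).} Grafting $G:\bigcup_{n\ge1}(\widehat{\mathcal T}^+_{\infty,2})^n\times(\mathbb Z^+)^{n-1}\to\widehat{\mathcal T}_{\infty,2}$: $G(t)=t$ for $n=1$; for $n\ge2$, $G(t_1,\dots,t_n;i_1,\dots,i_{n-1})$ attaches $t_1,\dots,t_n$ as the subtrees at the children of a new root labeled $0$, with label $i_k$ in the angle between the $k$-th and $(k+1)$-th children, and then for each $1<k<n$ with $t_k=\bullet$ removes that leaf and its edge and merges the two adjacent angles into one labeled by the sum of their labels. De-grafting: for $t\in\mathcal T^0_{\infty,2}$, $H(t)=(t_1,\dots,t_n;i_1,\dots,i_{n-1})$ lists the subtrees at the children of the root and the labels of the angles between them; for $t\in\mathcal T^+_{\infty,2}$, $H(t)=t$ ($n=1$). $B_{\infty,2}$ and $\widehat B_{\infty,2}$ are the free $\Bbbk$-modules on $\mathcal T_{\infty,2}$ and $\widehat{\mathcal T}_{\infty,2}$, and all maps are extended (multi)linearly. $\beta_{\infty,2}(t)$ is $t$ with root label changed to $1$ (for $t\in\mathcal T_{\infty,2}$ with either root label), and $\beta_{\infty,2}(\bullet)=\bullet$. For $t\in\mathcal T^+_{\infty,2}$, $\overline t$ is $t$ with root label changed to $0$; $\overline\bullet=\bullet$. Products $\ast$ on $\widehat B_{\infty,2}$ and $\diamond$ on $B_{\infty,2}$ are defined by mutual recursion: $\bullet\ast u=u\ast\bullet=u$; for $t,s\in\mathcal T_{\infty,2}$ with $H(t)=(t_1,\dots,t_n;i_1,\dots,i_{n-1})$,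 $H(s)=(s_1,\dots,s_m;j_1,\dots,j_{m-1})$, $$t\diamond s=G\bigl(t_1,\dots,t_{n-1},\beta_{\infty,2}(\overline t_n\ast\overline s_1),s_2,\dots,s_m;i_1,\dots,i_{n-1},j_1,\dots,j_{m-1}\bigr);$$ and for $u,v\in\mathcal T_{\infty,2}$, $u\ast v=\beta_{\infty,2}(u)\diamond v+u\diamond\beta_{\infty,2}(v)-u\diamond v$. $B^{-1}_{\infty,2}$ is $B_{\infty,2}$ with product $\diamond$. The triple $(B^{-1}_{\infty,2},Y,\beta_{\infty,2})$ is initial among triples $(A,x,\beta)$ with $(A,\beta)$ a Baxter algebra of weight $-1$ with $\beta^2=\beta$ and $x\in A$ (morphisms being algebra morphisms preserving the distinguished elements and commuting with the operators), so $\pi_\infty$ exists and is unique. *)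

(* Defs.v *)
From HB Require Import structures.
From mathcomp Require Import all_boot all_algebra.
From mathcomp Require Import finmap zify.
From mathcomp.multinomials Require Import monalg.

Set Implicit Arguments.
Unset Strict Implicit.
Unset Printing Implicit Defensive.

Import GRing.Theory.
Local Open Scope ring_scope.

(* The library makes {malg R[K]} an R-module only when 1 != 0 in R; this alias
   carries the module structure for every ring R. *)
Definition freemod (R : pzRingType) (K : choiceType) : Type := {malg R[K]}.

Section FreeModule.
Variables (R : pzRingType) (K : choiceType).
Local Notation V := (freemod R K).

HB.instance Definition _ := GRing.Zmodule.copy V {malg R[K]}.

Definition freemod_scale (c : R) (a : V) : V :=
  [malg k in msupp a => c * a@_k].

Lemma freemod_scaleE c (a : V) k : (freemod_scale c a)@_k = c * a@_k.
Proof. by rewrite /freemod_scale mcoeffE; case: msuppP => //; rewrite mulr0. Qed.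

Lemma freemod_scaleA c1 c2 (a : V) :
  freemod_scale c1 (freemod_scale c2 a) = freemod_scale (c1 * c2) a.
Proof. by apply/malgP => x; rewrite !freemod_scaleE mulrA. Qed.

Lemma freemod_scale1 : left_id 1 freemod_scale.
Proof. by move=> a; apply/malgP => k; rewrite !freemod_scaleE mul1r. Qed.

Lemma freemod_scaleDr : right_distributive freemod_scale +%R.
Proof.
move=> c a b; apply/malgP => k.
by rewrite !(mcoeffD, freemod_scaleE) mulrDr.
Qed.

Lemma freemod_scaleDl (a : V) : {morph freemod_scale^~ a : c d / c + d}.
Proof.
move=> c d; apply/malgP => k.
by rewrite !(mcoeffD, freemod_scaleE) mulrDl.
Qed.

HB.instance Definition _ := GRing.Zmodule_isLmodule.Build R V
  freemod_scaleA freemod_scale1 freemod_scaleDr freemod_scaleDl.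

Definition basis (k : K) : V := << 1 *g k >>.

Lemma mcoeffZ_freemod c (a : V) k : (c *: a)@_k = c * a@_k.
Proof. exact: freemod_scaleE. Qed.

Lemma mcoeff_basis k k' : (basis k)@_k' = (k == k')%:R.
Proof. exact: mcoeffU. Qed.

Lemma freemodE (a : V) : a = \sum_(k <- msupp a) a@_k *: basis k.
Proof.
rewrite [LHS]monalgE; apply: eq_bigr => k _; apply/malgP => k'.
by rewrite mcoeffZ_freemod mcoeff_basis mcoeffU mulr_natr.
Qed.

End FreeModule.

Section LinearExtension.
Variables (R : pzRingType) (K : choiceType) (W : lmodType R).

Definition lin_ext (f : K -> W) (a : freemod R K) : W :=
  \sum_(k <- msupp a) a@_k *: f k.

Lemma lin_extw f (a : freemod R K) (d : {fset K}) : {subset msupp a <= d} ->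
  lin_ext f a = \sum_(k <- d) a@_k *: f k.
Proof.
move=> sad; rewrite /lin_ext; apply: big_fset_incl; first exact/fsubsetP.
by move=> k _ /mcoeff_outdom ->; rewrite scale0r.
Qed.

Lemma lin_ext_is_linear f : linear (lin_ext f).
Proof.
move=> c a b; pose d := (msupp a `|` msupp b `|` msupp (c *: a + b))%fset.
rewrite !(@lin_extw f _ d); last 3 first.
- by move=> k kb; rewrite !in_fsetU kb orbT.
- by move=> k ka; rewrite !in_fsetU ka.
- by move=> k kab; rewrite !in_fsetU kab orbT.
rewrite scaler_sumr -big_split; apply: eq_bigr => k _ /=.
by rewrite mcoeffD mcoeffZ_freemod scalerDl scalerA.
Qed.

HB.instance Definition _ f :=
  GRing.isLinear.Build R (freemod R K) W *:%R (lin_ext f) (lin_ext_is_linear f).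

Lemma lin_ext_basis f k : lin_ext f (basis R k) = f k.
Proof.
rewrite (@lin_extw f _ [fset k]%fset) => [|x].
  by rewrite big_seq_fset1 mcoeff_basis eqxx scale1r.
by rewrite /basis msuppU; case: ifP => // _; rewrite in_fset0.
Qed.

Lemma eq_lin_ext f g a : f =1 g -> lin_ext f a = lin_ext g a.
Proof. by move=> fg; apply: eq_bigr => k _; rewrite fg. Qed.

End LinearExtension.

Lemma linear_lin_ext (R : pzRingType) (K : choiceType) (W W' : lmodType R)
    (L : {linear W -> W'}) (f : K -> W) a :
  L (lin_ext f a) = lin_ext (fun k => L (f k)) a.
Proof. by rewrite /lin_ext linear_sum; apply: eq_bigr => k _; rewrite linearZ. Qed.

Lemma lin_ext_comp (R : pzRingType) (K K' : choiceType) (W : lmodType R)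
    (f : K' -> W) (g : K -> K') a :
  lin_ext f (lin_ext (fun k => basis R (g k)) a) = lin_ext (fun k => f (g k)) a.
Proof.
by rewrite linear_lin_ext; apply: eq_lin_ext => k; rewrite [LHS]lin_ext_basis.
Qed.

Definition bilin_ext (R : pzRingType) (K L : choiceType) (W : lmodType R)
    (f : K -> L -> W) (a : freemod R K) (b : freemod R L) : W :=
  lin_ext (fun k => lin_ext (f k) b) a.

Lemma bilin_ext_basis (R : pzRingType) (K L : choiceType) (W : lmodType R)
    (f : K -> L -> W) k l : bilin_ext f (basis R k) (basis R l) = f k l.
Proof. by rewrite /bilin_ext !lin_ext_basis. Qed.

(* The algebra M_infinity: the free module on nonempty words in two letters,
   x_0 being [false] and x_1 being [true]. *)

Definition x0 : bool := false.
Definition x1 : bool := true.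

Record word := Word { letters :> seq bool; _ : letters != [::] }.

HB.instance Definition _ := [isSub for letters].
HB.instance Definition _ := [Choice of word by <:].

Lemma word_cat_proof (u v : word) : letters u ++ letters v != [::].
Proof. by case: u => -[|x s]. Qed.

Definition word_cat (u v : word) : word := Word (word_cat_proof u v).

Lemma word_map_proof (f : bool -> bool) (u : word) : map f u != [::].
Proof. by case: u => -[|x s]. Qed.

Definition word_map f (u : word) : word := Word (word_map_proof f u).

Definition Minf (R : comPzRingType) := freemod R word.

Definition mono (R : comPzRingType) (s : seq bool) (s_neq0 : s != [::])
  : Minf R := basis R (Word s_neq0).

Definition gen0 (R : comPzRingType) : Minf R := @mono R [:: x0] isT.
Definition gen1 (R : comPzRingType) : Minf R := @mono R [:: x1] isT.

Definition mulM (R : comPzRingType) : Minf R -> Minf R -> Minf R :=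
  bilin_ext (fun u v => basis R (word_cat u v)).

Lemma mulM_mono (R : comPzRingType) (s s' : seq bool)
    (h : s != [::]) (h' : s' != [::]) (hh' : s ++ s' != [::]) :
  mulM (mono R h) (mono R h') = mono R hh'.
Proof. by rewrite /mulM bilin_ext_basis; congr basis; apply: val_inj. Qed.

(* Substitution of x_1 for both letters. *)
Definition betaM (R : comPzRingType) : Minf R -> Minf R :=
  lin_ext (fun u => basis R (word_map (fun=> x1) u)).

HB.instance Definition _ (R : comPzRingType) :=
  GRing.Linear.copy (@betaM R) (lin_ext _).

Lemma betaM_gen0 (R : comPzRingType) : betaM (gen0 R) = gen1 R.
Proof. by rewrite /betaM lin_ext_basis; congr basis; apply: val_inj. Qed.

Lemma betaM_gen1 (R : comPzRingType) : betaM (gen1 R) = gen1 R.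
Proof. by rewrite /betaM lin_ext_basis; congr basis; apply: val_inj. Qed.

Lemma betaM_mul (R : comPzRingType) (a b : Minf R) :
  betaM (mulM a b) = mulM (betaM a) (betaM b).
Proof.
rewrite /mulM /bilin_ext /betaM linear_lin_ext lin_ext_comp.
apply: eq_lin_ext => u; rewrite linear_lin_ext lin_ext_comp.
apply: eq_lin_ext => v; rewrite [LHS]lin_ext_basis; congr basis.
by apply: val_inj; rewrite /= map_cat.
Qed.

(* Rooted planar trees: a root label, the children and the angle labels, both
   from left to right; the node labels 0 and 1 are [false] and [true], and a
   positive angle label is enforced by [shape_ok].  [Leaf] is the single-node tree. *)

Inductive tree := Leaf | Node of bool & seq tree & seq nat.

Section TreeInd.
Variable P : tree -> Prop.
Hypothesis PLeaf : P Leaf.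
Hypothesis PNode :
  forall l ts ks, (forall t, List.In t ts -> P t) -> P (Node l ts ks).

Fixpoint tree_nested_ind (t : tree) : P t :=
  match t with
  | Leaf => PLeaf
  | Node l ts ks => PNode l ks
      ((fix loop ts : forall t, List.In t ts -> P t :=
          match ts with
          | [::] => fun _ abs => False_ind _ abs
          | t1 :: ts' => fun t tin =>
              match tin with
              | or_introl e => ecast z (P z) e (tree_nested_ind t1)
              | or_intror tin' => loop ts' t tin'
              end
          end) ts)
  end.
End TreeInd.

Fixpoint tree_encode (t : tree) : GenTree.tree (bool * seq nat) :=
  match t with
  | Leaf => GenTree.Node 0 [::]
  | Node l ts ks =>
      GenTree.Node 1 (GenTree.Leaf (l, ks) :: map tree_encode ts)
  end.

Fixpoint tree_decode (g : GenTree.tree (bool * seq nat)) : tree :=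
  match g with
  | GenTree.Node _ (GenTree.Leaf (l, ks) :: gs) =>
      Node l (map tree_decode gs) ks
  | _ => Leaf
  end.

Lemma tree_encodeK : cancel tree_encode tree_decode.
Proof.
elim/tree_nested_ind => //= l ts ks IH; congr Node.
elim: ts IH => //= t ts IHts IH; rewrite IH; last by left.
by rewrite IHts // => t' t'in; apply: IH; right.
Qed.

HB.instance Definition _ := Choice.copy tree (can_type tree_encodeK).

Lemma tree_mem_ind (P : tree -> Prop) :
  P Leaf ->
  (forall l ts ks, {in ts, forall t, P t} -> P (Node l ts ks)) ->
  forall t, P t.
Proof.
move=> PL PN; elim/tree_nested_ind => // l ts ks IH; apply: PN.
elim: ts IH => // t ts IHts IH x; rewrite inE => /orP[/eqP ->|].
  by apply: IH; left.
by apply: IHts => y yin; apply: IH; right.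
Qed.

Definition internal (t : tree) : bool := if t is Node _ _ _ then true else false.
Definition children (t : tree) : seq tree :=
  if t is Node _ ts _ then ts else [::].
Definition angles (t : tree) : seq nat :=
  if t is Node _ _ ks then ks else [::].
Definition root_label (t : tree) : bool :=
  if t is Node l _ _ then l else false.
Definition set_root (l : bool) (t : tree) : tree :=
  if t is Node _ ts ks then Node l ts ks else Leaf.

Fixpoint deg_angle (t : tree) : nat :=
  if t is Node _ ts ks then (sumn ks + sumn (map deg_angle ts))%N else 0%N.

Definition middle (ts : seq tree) : seq tree := take (size ts - 2) (behead ts).

Fixpoint shape_ok (t : tree) : bool :=
  if t is Node _ ts ks then
    [&& (1 < size ts)%N, size ts == (size ks).+1, all (fun i => 0 < i)%N ks,
        all internal (middle ts) & all shape_ok ts]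
  else true.

Fixpoint all_labels1 (t : tree) : bool :=
  if t is Node l ts _ then l && all all_labels1 ts else true.

Definition inT (t : tree) : bool :=
  [&& internal t, shape_ok t & all all_labels1 (children t)].
Definition inTplus (t : tree) : bool := inT t && root_label t.
Definition inThat (t : tree) : bool := (t == Leaf) || inT t.
Definition inThat_plus (t : tree) : bool := (t == Leaf) || inTplus t.

(* The set T_{infinity,2}. *)
Record dtree := DTree { dtree_val :> tree; _ : inT dtree_val }.

HB.instance Definition _ := [isSub for dtree_val].
HB.instance Definition _ := [Choice of dtree by <:].

Definition Y : dtree := @DTree (Node false [:: Leaf; Leaf] [:: 1%N]) isT.

Lemma inT_set_root l t : inT t -> inT (set_root l t).
Proof. by case: t. Qed.

Definition dtree_beta (t : dtree) : dtree :=
  DTree (inT_set_root true (valP t)).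

(* [merge_leaves i ks ts] is the part of the grafted tree lying to the right of
   its first child: [i] is the label accumulated so far, [ts] are the remaining
   children and [ks] the angle labels between them.  The head of [ts] is the
   last child of the root exactly when [ks] is empty. *)
Fixpoint merge_leaves (i : nat) (ks : seq nat) (ts : seq tree) :
    seq nat * seq tree :=
  match ks, ts with
  | j :: ks', Leaf :: ts' => merge_leaves (i + j) ks' ts'
  | j :: ks', t :: ts' =>
      let r := merge_leaves j ks' ts' in (i :: r.1, t :: r.2)
  | _, _ => ([:: i], ts)
  end.

(* Grafting; the last branch is never reached by an n-tuple of trees with n - 1
   angle labels and n > 0. *)
Definition graft (ts : seq tree) (ks : seq nat) : tree :=
  match ts, ks with
  | [:: t], [::] => t
  | t :: ts', i :: ks' =>
      let r := merge_leaves i ks' ts' in Node false (t :: r.2) r.1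
  | _, _ => Leaf
  end.

Definition degraft (t : tree) : seq tree * seq nat :=
  match t with
  | Node false ts ks => (ts, ks)
  | _ => ([:: t], [::])
  end.

Section Products.
Variable R : comPzRingType.

Local Notation raw := (freemod R tree).

Definition raw_beta : raw -> raw := lin_ext (fun t => basis R (set_root true t)).

(* The products are computed in the free module on all trees.  The mutual
   recursion is on an upper bound [n] for its depth; [raw_starE] and
   [raw_diamondE] below are the recursion equations without the bound. *)
Fixpoint star_ (n : nat) (u v : tree) : raw :=
  if n is n'.+1 then
    if ~~ internal u then basis R v
    else if ~~ internal v then basis R u
    else diamond_ n' (set_root true u) v + diamond_ n' u (set_root true v)
         - diamond_ n' u v
  else 0
with diamond_ (n : nat) (t s : tree) : raw :=
  if n is n'.+1 then
    let: (ts, ks) := degraft t in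
    let: (ss, js) := degraft s in
    lin_ext (fun x => basis R
               (graft (take (size ts).-1 ts ++ x :: behead ss) (ks ++ js)))
      (raw_beta (star_ n' (set_root false (last Leaf ts))
                          (set_root false (head Leaf ss))))
  else 0.

Fixpoint nodes (t : tree) : nat :=
  if t is Node _ ts _ then (sumn (map nodes ts)).+1 else 0.

Definition depth_bound (t s : tree) : nat := (4 * (nodes t + nodes s) + 4)%N.

Definition raw_star (u v : tree) : raw := star_ (depth_bound u v) u v.
Definition raw_diamond (t s : tree) : raw := diamond_ (depth_bound t s) t s.

Let mstar u v :=
  (4 * (nodes u + nodes v) + if root_label u || root_label v then 3 else 1)%N.
Let mdia u v :=
  (4 * (nodes u + nodes v) + if root_label u && root_label v then 2 else 0)%N.

Lemma nodes_set_root l t : nodes (set_root l t) = nodes t.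
Proof. by case: t. Qed.

Lemma root_set_root0 t : root_label (set_root false t) = false.
Proof. by case: t. Qed.

Lemma root_set_root1 t : internal t -> root_label (set_root true t) = true.
Proof. by case: t. Qed.

Lemma internal_set_root l t : internal (set_root l t) = internal t.
Proof. by case: t. Qed.

Lemma nodes_sumn ts t : t \in ts -> (nodes t <= sumn (map nodes ts))%N.
Proof.
elim: ts => //= t' ts IH; rewrite inE => /orP[/eqP ->|/IH]; first exact: leq_addr.
by move/leq_trans; apply; apply: leq_addl.
Qed.

Lemma nodes_last t : internal t ->
  (nodes (last Leaf (degraft t).1) + ~~ root_label t <= nodes t)%N.
Proof.
case: t => // -[] ts ks _ /=; first by rewrite addn0.
rewrite addn1 ltnS; case/lastP: ts => // ts t.
by rewrite last_rcons nodes_sumn // mem_rcons mem_head.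
Qed.

Lemma nodes_head t : internal t ->
  (nodes (head Leaf (degraft t).1) + ~~ root_label t <= nodes t)%N.
Proof.
case: t => // -[] ts ks _ /=; first by rewrite addn0.
by rewrite addn1 ltnS; case: ts => //= t ts; rewrite leq_addr.
Qed.

Lemma fuel_irrelevant n :
  (forall m u v, (mstar u v < n)%N -> (mstar u v < m)%N ->
     star_ n u v = star_ m u v) /\
  (forall m t s, internal t -> internal s ->
     (mdia t s < n)%N -> (mdia t s < m)%N ->
     diamond_ n t s = diamond_ m t s).
Proof.
elim: n => [|n [IHs IHd]]; first by split.
split=> -[|m] //.
  move=> u v; rewrite !ltnS => un um /=.
  case: ifP => // /negbFE iu; case: ifP => // /negbFE iv.
  have lt1 : (mdia (set_root true u) v < mstar u v)%N.
    rewrite /mdia /mstar nodes_set_root root_set_root1 //=.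
    by case: (root_label u); case: (root_label v) => /=; lia.
  have lt2 : (mdia u (set_root true v) < mstar u v)%N.
    rewrite /mdia /mstar nodes_set_root root_set_root1 //=.
    by case: (root_label u); case: (root_label v) => /=; lia.
  have lt3 : (mdia u v < mstar u v)%N.
    rewrite /mdia /mstar.
    by case: (root_label u); case: (root_label v) => /=; lia.
  congr (_ + _ - _); apply: IHd; rewrite ?internal_set_root //;
    exact: leq_trans _ un || exact: leq_trans _ um.
move=> t s it ks'; rewrite !ltnS => tn tm /=.
have lt : (mstar (set_root false (last Leaf (degraft t).1))
                 (set_root false (head Leaf (degraft s).1)) < mdia t s)%N.
  have := nodes_last it; have := nodes_head ks'.
  rewrite /mstar /mdia !nodes_set_root !root_set_root0 /=.
  by case: (root_label t); case: (root_label s) => /=; lia.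
case: (degraft t) (degraft s) lt => [ts ks] [ss js] /= lt.
by rewrite (IHs m) //; [exact: leq_trans lt tn | exact: leq_trans lt tm].
Qed.

Lemma raw_star_leafl u : raw_star Leaf u = basis R u.
Proof. by rewrite /raw_star /depth_bound addn4. Qed.

Lemma raw_star_leafr u : raw_star u Leaf = basis R u.
Proof. by rewrite /raw_star /depth_bound addn4; case: u. Qed.

Lemma raw_starE u v : internal u -> internal v ->
  raw_star u v = raw_diamond (set_root true u) v
                 + raw_diamond u (set_root true v) - raw_diamond u v.
Proof.
move=> iu iv; rewrite /raw_star.
have -> : star_ (depth_bound u v) u v = star_ (depth_bound u v).+1 u v.
  apply: (fuel_irrelevant _).1; rewrite /mstar /depth_bound;
  by case: (_ || _); lia.
rewrite [LHS]/= iu iv /= /raw_diamond.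
by congr (diamond_ _ _ _ + diamond_ _ _ _ - _);
  rewrite /depth_bound nodes_set_root.
Qed.

Lemma raw_diamondE t s : internal t -> internal s ->
  raw_diamond t s =
    let: (ts, ks) := degraft t in
    let: (ss, js) := degraft s in
    lin_ext (fun x => basis R
               (graft (take (size ts).-1 ts ++ x :: behead ss) (ks ++ js)))
      (raw_beta (raw_star (set_root false (last Leaf ts))
                          (set_root false (head Leaf ss)))).
Proof.
move=> it ks'; rewrite /raw_diamond.
have -> : diamond_ (depth_bound t s) t s = diamond_ (depth_bound t s).+1 t s.
  apply: (fuel_irrelevant _).2 => //; rewrite /mdia /depth_bound;
  by case: (_ && _); lia.
rewrite [LHS]/=.
have := nodes_last it; have := nodes_head ks'.
case: (degraft t) (degraft s) => [ts ks] [ss js] /= les let_.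
congr (lin_ext _ (raw_beta _)); rewrite /raw_star.
apply: (fuel_irrelevant _).1;
  rewrite /mstar /depth_bound !nodes_set_root !root_set_root0 /=; lia.
Qed.

Definition supported (P : pred tree) (a : raw) : Prop :=
  {in msupp a, forall t, P t}.

Lemma supported0 P : supported P 0.
Proof. by move=> t; rewrite msupp0 in_fset0. Qed.

Lemma supportedD P a b : supported P a -> supported P b -> supported P (a + b).
Proof.
move=> Pa Pb t /(fsubsetP (msuppD_le _ _)).
by rewrite in_fsetU => /orP[/Pa|/Pb].
Qed.

Lemma supportedN P a : supported P a -> supported P (- a).
Proof. by move=> Pa t; rewrite msuppN => /Pa. Qed.

Lemma supportedZ P c a : supported P a -> supported P (c *: a).
Proof.
move=> Pa t; rewrite -mcoeff_neq0 mcoeffZ_freemod => nz; apply: Pa.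
by rewrite -mcoeff_neq0; apply: contraNneq nz => ->; rewrite mulr0.
Qed.

Lemma supported_basis (P : pred tree) t : P t -> supported P (basis R t).
Proof.
move=> Pt x; rewrite /basis msuppU; case: ifP => _; first by rewrite in_fset0.
by rewrite in_fset1 => /eqP ->.
Qed.

Lemma supported_ext (P Q : pred tree) (f : tree -> tree) a :
  (forall t, P t -> Q (f t)) -> supported P a ->
  supported Q (lin_ext (fun t => basis R (f t)) a).
Proof.
move=> PQ Pa; rewrite /lin_ext big_seq_cond.
elim/big_ind: _ => [|x y|t /andP[ta _]]; first exact: supported0.
- exact: supportedD.
- by apply: supportedZ; apply: supported_basis; apply: PQ; apply: Pa.
Qed.

Lemma inThat_plusE t : inThat_plus t = shape_ok t && all_labels1 t.
Proof.
by case: t => // l ts ks; rewrite /inThat_plus /= /inTplus /inT /= -andbA [l && _]andbC.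
Qed.

Lemma set_root0_inThat t : inThat_plus t -> inThat (set_root false t).
Proof. by case: t => // l ts ks /andP[/(inT_set_root false)]. Qed.

Lemma set_root1_inThat t : inThat t -> inThat_plus (set_root true t).
Proof.
by case: t => // l ts ks /(inT_set_root true) h; rewrite /inThat_plus /inTplus h.
Qed.

Lemma set_root1_inT t : inT t -> inTplus (set_root true t).
Proof. by move=> h; rewrite /inTplus inT_set_root //; case: t h. Qed.

Lemma inTplus_that t : inTplus t -> inThat_plus t.
Proof. by rewrite /inThat_plus orbC => ->. Qed.

Lemma inT_children t : inT t -> all inThat_plus (children t).
Proof.
case: t => // l ts ks /and3P[_ /= /and5P[_ _ _ _ h1] h2].
apply/allP => t tin; rewrite inThat_plusE.
by rewrite (allP h1) // (allP h2).
Qed.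

Lemma merge_leavesP i ks ts : (0 < i)%N -> all (fun i => 0 < i)%N ks ->
  all inThat_plus ts -> size ts = (size ks).+1 ->
  let r := merge_leaves i ks ts in
  [/\ (0 < size r.1)%N, size r.2 = size r.1, all (fun i => 0 < i)%N r.1,
      all inThat_plus r.2 & all internal (take (size r.2).-1 r.2)].
Proof.
elim: ks i ts => [|j ks IH] i [|t ts] //=.
  by case: ts => //= i0 _ ht _; rewrite i0 ht.
move=> i0 /andP[j0 is0] /andP[ht hts] [sz].
case: t ht => [|l us js] ht.
  by apply: IH => //; rewrite addn_gt0 i0.
have [h1 h2 h3 h4 h5] := IH j ts j0 is0 hts sz.
split=> //=; first by rewrite h2.
- by rewrite i0.
- by rewrite ht.
- by move: h1 h5; rewrite -h2; case: (merge_leaves _ _ _).2.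
Qed.

Lemma graft_inT ts ks : (1 < size ts)%N -> all (fun i => 0 < i)%N ks ->
  all inThat_plus ts -> size ts = (size ks).+1 -> inT (graft ts ks).
Proof.
case: ts ks => [|t ts] [|i ks] //=; first by case: ts.
move=> _ /andP[i0 is0] /andP[ht hts] [sz].
have /= [h1 h2 h3 h4 h5] := merge_leavesP i0 is0 hts sz.
move: ht h1 h2 h3 h4 h5; case: ts hts sz => // t' ts _ _.
case: (merge_leaves _ _ _) => /= ls us ht h1 h2 h3 h4 h5.
rewrite /inT /= ltnS -h2 in h1 *; rewrite h1 eqxx h3 /middle /=.
rewrite -subn1 subSS subn1 in h5 *; rewrite h5 /=.
move: ht; rewrite inThat_plusE => /andP[-> ->] /=.
by rewrite -all_predI; apply: sub_all h4 => x; rewrite /= inThat_plusE.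
Qed.

Lemma degraftP t : inT t ->
  let d := degraft t in
  [/\ all inThat_plus d.1, size d.1 = (size d.2).+1
    & all (fun i => 0 < i)%N d.2].
Proof.
move=> tT; case: (boolP (root_label t)) => lt.
  have -> : degraft t = ([:: t], [::]) by case: t tT lt => // -[].
  by rewrite /= inTplus_that // /inTplus tT.
have -> : degraft t = (children t, angles t) by case: t tT lt => // -[].
split; first exact: inT_children.
  by case: t tT lt => // l ts ks /and3P[_ /= /and5P[_ /eqP ->]].
by case: t tT lt => // l ts ks /and3P[_ /= /and5P[]].
Qed.

Lemma closed_rec n :
  (forall u v, inThat u -> inThat v -> supported inThat (star_ n u v)) /\
  (forall u v, inT u -> inT v -> supported inT (star_ n u v)) /\
  (forall t s, inT t -> inT s -> supported inT (diamond_ n t s)).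
Proof.
elim: n => [|n [IHh [IHs IHd]]]; first by do !split => *; exact: supported0.
have inTi t : inT t -> internal t by case: t.
have star u v : inT u -> inT v -> supported inT (star_ n.+1 u v).
  move=> uT vT; rewrite /= !inTi //=.
  by apply: supportedD; [apply: supportedD|apply: supportedN];
    apply: IHd => //; apply: inT_set_root.
split; last split => // t s tT sT.
  move=> u v /orP[/eqP -> vT|uT]; first exact: supported_basis.
  case/orP => [/eqP ->|vT]; last first.
    by move=> x /(star _ _ uT vT) xT; rewrite /inThat xT orbT.
  by rewrite /= inTi //=; apply: supported_basis; rewrite /inThat uT orbT.
case: (boolP (root_label t && root_label s)) => [/andP[lt ls]|ll] /=.
  have -> : degraft t = ([:: t], [::]) by case: (t) lt => // -[].
  have -> : degraft s = ([:: s], [::]) by case: (s) ls => // -[].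
  rewrite /=; apply: (@supported_ext inT inT id) => //.
  by apply: supported_ext (IHs _ _ _ _) => [x||]; exact: inT_set_root.
have sz : (2 < size (degraft t).1 + size (degraft s).1)%N.
  have := degraftP tT; have := degraftP sT.
  move: ll; rewrite negb_and => /orP[] l0 [_ s1 _] [_ s2 _].
    suff : (1 < size (degraft t).1)%N by lia.
    by case: (t) l0 tT => // -[] //= ts ks _ /and3P[_ /= /andP[]].
  suff : (1 < size (degraft s).1)%N by lia.
  by case: (s) l0 sT => // -[] //= ts ks _ /and3P[_ /= /andP[]].
move: sz (degraftP tT) (degraftP sT).
case: (degraft t) (degraft s) => [ts ks] [ss js] /= sz [ht zt kt] [hs zs js0].
apply: (@supported_ext inThat_plus) => [x xP|].
  apply: graft_inT.
  - by rewrite size_cat size_take /= size_behead ltn_predL zt /=; lia.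
  - by rewrite all_cat kt.
  - rewrite all_cat /= xP; apply/and3P; split=> //.
      by apply/allP => y /mem_take /(allP ht).
    by apply/allP => y /mem_behead /(allP hs).
  - by rewrite !size_cat size_take /= size_behead ltn_predL zt zs /= !addnS.
apply: supported_ext (IHh _ _ _ _) => [x||]; first exact: set_root1_inThat.
  apply: set_root0_inThat; case/lastP: ts ht {zt sz} => // ts' y.
  by rewrite all_rcons last_rcons => /andP[].
by apply: set_root0_inThat; case: (ss) hs => //= y ss' /andP[].
Qed.

Lemma raw_diamond_inT t s : inT t -> inT s -> supported inT (raw_diamond t s).
Proof. exact: (closed_rec _).2.2. Qed.

(* The module B_{infinity,2}; [restrict] kills the trees outside of
   T_{infinity,2} and is only applied to elements of the span of
   T_{infinity,2}, on which it is the identity. *)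

Definition B := freemod R dtree.

Definition include : B -> raw := lin_ext (fun t : dtree => basis R (t : tree)).

Definition restrict : raw -> B :=
  lin_ext (fun t => if insub t is Some t' then basis R (t' : dtree) else 0).

Lemma restrictK a : supported inT a -> include (restrict a) = a.
Proof.
move=> aT; rewrite /include /restrict linear_lin_ext [RHS]freemodE.
rewrite /lin_ext; apply: eq_big_seq => t ta; congr (_ *: _).
by rewrite insubT ?aT // => h; rewrite [LHS]lin_ext_basis.
Qed.

Definition diamond_basis (t s : dtree) : B := restrict (raw_diamond t s).

Lemma include_diamond_basis (t s : dtree) :
  include (diamond_basis t s) = raw_diamond t s.
Proof. by apply/restrictK/raw_diamond_inT; apply: valP. Qed.

Definition diamond : B -> B -> B := bilin_ext diamond_basis.

Definition betaB : B -> B := lin_ext (fun t => basis R (dtree_beta t)).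

End Products.

(* Only the data of the two algebras with operators enter in the notion of
   morphism; [A1] and [A2] have products [m1], [m2] and operators [b1], [b2]. *)
Definition baxter_morphism (R : pzRingType) (A1 A2 : lmodType R)
    (m1 : A1 -> A1 -> A1) (b1 : A1 -> A1)
    (m2 : A2 -> A2 -> A2) (b2 : A2 -> A2) (f : {linear A1 -> A2}) : Prop :=
  (forall a b, f (m1 a b) = m2 (f a) (f b)) /\
  (forall a, f (b1 a) = b2 (f a)).

(* x_1^{deg t_1} x_0^{i_1} x_1^{deg t_2} ... x_0^{i_{n-1}} x_1^{deg t_n} *)
Definition alternating_seq (ts : seq tree) (ks : seq nat) : seq bool :=
  nseq (deg_angle (head Leaf ts)) x1 ++
  flatten [seq nseq p.1 x0 ++ nseq (deg_angle p.2) x1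
             | p <- zip ks (behead ts)].

Lemma dtree_deg_neq0 (t : dtree) : nseq (deg_angle t) x1 != [::].
Proof.
case: t => -[//|l [//|t1 [//|t2 ts]] [//|i ks]] /= h.
by case/and3P: h => _ /= /and4P[_ /andP[]]; case: i.
Qed.

Lemma dtree_alternating_neq0 (t : dtree) :
  alternating_seq (children t) (angles t) != [::].
Proof.
case: t => -[//|l [//|t1 [//|t2 ts]] [//|i ks]] /= h.
case/and3P: h => _ /= /and4P[_ /andP[i0 _] _ _] _.
by rewrite /alternating_seq /=; case: (deg_angle t1) => //; case: i i0.
Qed.

(* Main.v *)
Require Import Defs.
From mathcomp Require Import all_boot all_algebra.
From mathcomp Require Import zify.

(** The set of trees is generated from [Y] by two operations which every
    Baxter morphism respects: relabelling the root by 1, and those products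
    [t <> s] in which the last subtree of [t] or the first subtree of [s] is a
    leaf.  In such a product the recursive call, to the auxiliary product
    [raw_star], has a leaf as an argument and a leaf is the unit of it, so
    the product is a single tree, written [glue t s] below, and no linear
    combination ever appears.

    The generation is proved by induction on the total angle degree
    ([dtree_glue_ind]).  A tree with root label 1 is the image under the
    operator of the same tree with root label 0.  Now let the root have label 0,
    subtrees [t_1, ..., t_n] and angles [i_1, ..., i_(n-1)], and write [Y_i] for
    the tree with two leaves and one angle [i].
    - If [t_1] is not a leaf, the tree is the product of [t_1] and the tree with
      [t_1] replaced by a leaf.
    - If [t_1] is a leaf and [t_2] is not, it is the product of [Y_(i_1)] and
      the tree with subtrees [t_2, ..., t_n], which is [t_2] itself if [n = 2].
    - Otherwise it is [Y_i] for some [i]; here [Y_1] is [Y] and [Y_(i+1)] is the product of [Y] and [Y_i].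
    All angle labels are positive, so both factors have smaller degree.

    The word attached to a tree ([tree_word]) is compatible with both
    operations.  Its length is the angle degree, so relabelling the root by 1
    amounts to replacing every letter by [x_1] ([tree_word_set_root1]).
    Glueing concatenates words ([tree_word_glue]): merging two angles around a
    removed leaf does not change the word because
    [x_0^i x_1^0 x_0^j = x_0^(i+j)]. *)

Set Implicit Arguments.
Unset Strict Implicit.
Unset Printing Implicit Defensive.

Import GRing.Theory.
Local Open Scope ring_scope.

(** * Words of trees *)

(** De-grafting makes the two cases of the statement one: a tree with root label
    1 has itself as its only subtree and no angle, which gives a power of
    [x_1]. *)
Definition tree_word (t : tree) : seq bool :=
  alternating_seq (degraft t).1 (degraft t).2.

Lemma degraft_label1 t : root_label t -> degraft t = ([:: t], [::]).
Proof. by case: t => // -[]. Qed.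

Lemma degraft_inThat_plus t : inThat_plus t -> degraft t = ([:: t], [::]).
Proof. by case/orP => [/eqP ->|/andP[_ /degraft_label1]]. Qed.

Lemma tree_word_label1 t : root_label t -> tree_word t = nseq (deg_angle t) x1.
Proof. by move=> lt; rewrite /tree_word degraft_label1 // /alternating_seq /= cats0. Qed.

Lemma tree_word_label0 t : internal t -> ~~ root_label t ->
  tree_word t = alternating_seq (children t) (angles t).
Proof. by case: t => // -[]. Qed.

Lemma alternating_seq_cons t ts k ks : ts != [::] ->
  alternating_seq (t :: ts) (k :: ks) =
    nseq (deg_angle t) x1 ++ nseq k x0 ++ alternating_seq ts ks.
Proof. by case: ts => // t' ts _; rewrite /alternating_seq /= -!catA. Qed.

Lemma size_alternating_seq ts ks : size ts = (size ks).+1 ->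
  size (alternating_seq ts ks) = (sumn ks + sumn (map deg_angle ts))%N.
Proof.
elim: ks ts => [|k ks IH] [|t ts] //= [szts].
  by case: ts szts => // _; rewrite /alternating_seq /= cats0 size_nseq addn0.
rewrite alternating_seq_cons; last by case: ts szts.
by rewrite 2!size_cat IH // !size_nseq; lia.
Qed.

Lemma size_tree_word t : inT t -> size (tree_word t) = deg_angle t.
Proof.
move=> tT; have [_ szt _] := degraftP tT.
rewrite /tree_word size_alternating_seq //.
by case: t {tT szt} => //= -[] ts ks /=; rewrite ?addn0 ?add0n.
Qed.

Lemma deg_angle_gt0 t : inT t -> (0 < deg_angle t)%N.
Proof.
by move=> tT; have := dtree_deg_neq0 (DTree tT); case: (deg_angle _).
Qed.

Lemma tree_word_neq0 (t : dtree) : tree_word t != [::].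
Proof.
by rewrite -size_eq0 size_tree_word ?(valP t) // -lt0n deg_angle_gt0 // (valP t).
Qed.

Definition dtree_word (t : dtree) : word := Word (tree_word_neq0 t).

(** Both sides are powers of [x_1], and the length of the word is the angle
    degree, which ignores the root label. *)
Lemma tree_word_set_root1 t : inT t ->
  tree_word (set_root true t) = map (fun=> x1) (tree_word t).
Proof.
move=> tT; rewrite tree_word_label1; last by case: t tT.
have -> : deg_angle (set_root true t) = size (tree_word t).
  by rewrite size_tree_word //; case: t tT.
by elim: (tree_word t) => //= a s ->.
Qed.

(** * Grafting and words *)

(** The two angles around a removed leaf are consecutive powers of [x_0] in the
    word, because the leaf has degree 0. *)
Lemma alternating_seq_merge_leaves t i ks ts : size ts = (size ks).+1 ->
  let r := merge_leaves i ks ts in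
  alternating_seq (t :: r.2) r.1 = alternating_seq (t :: ts) (i :: ks).
Proof.
rewrite /alternating_seq /= => szts; congr (_ ++ _).
elim: ks i ts szts => [|j ks IH] i [|t' ts] //= [szts].
case: t' => [|l us js] /=; last by rewrite IH.
by rewrite IH // cats0; case: ts szts {IH} => //= t' ts _; rewrite nseqD -!catA.
Qed.

Lemma tree_word_graft ts ks : size ts = (size ks).+1 -> all inThat_plus ts ->
  tree_word (graft ts ks) = alternating_seq ts ks.
Proof.
case: ts ks => [|t [|t' ts]] [|i ks] //= szts.
  by case/andP=> tP _; rewrite /tree_word degraft_inThat_plus.
move=> _; apply: (@alternating_seq_merge_leaves t i ks (t' :: ts)).
by case: szts => /= ->.
Qed.

(** The last subtree of the left factor and the first one of the right factor
    both contribute a power of [x_1]; the subtree [x] carries the product of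
    these two powers. *)
Lemma alternating_seq_cat ts t ks s ss js x : size ts = size ks ->
  deg_angle x = (deg_angle t + deg_angle s)%N ->
  alternating_seq (ts ++ x :: ss) (ks ++ js) =
    alternating_seq (rcons ts t) ks ++ alternating_seq (s :: ss) js.
Proof.
move=> szts degx; elim: ks ts szts => [|k ks IH] [|t' ts] // => [_|[szts]].
  by rewrite /alternating_seq /= degx nseqD cats0 -catA.
rewrite !cat_cons rcons_cons.
rewrite [LHS]alternating_seq_cons; last by case: ts {szts}.
rewrite [X in _ = X ++ _]alternating_seq_cons; last by case: ts {szts}.
by rewrite IH // -!catA.
Qed.

(** * Products without recursion *)

(** This condition stops the recursion of the product after one step. *)
Definition leaf_joined (t s : tree) : bool :=
  ~~ internal (last Leaf (degraft t).1) || ~~ internal (head Leaf (degraft s).1).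

(** The value of the auxiliary product at the joint, of which a leaf is the
    unit. *)
Definition glue_root (t s : tree) : tree :=
  if internal (last Leaf (degraft t).1) then last Leaf (degraft t).1
  else head Leaf (degraft s).1.

Definition glue (t s : tree) : tree :=
  graft (take (size (degraft t).1).-1 (degraft t).1
           ++ glue_root t s :: behead (degraft s).1)
        ((degraft t).2 ++ (degraft s).2).

Lemma last_inThat_plus ts : all inThat_plus ts -> inThat_plus (last Leaf ts).
Proof. by case/lastP: ts => // ts t; rewrite all_rcons last_rcons => /andP[]. Qed.

Lemma head_inThat_plus ts : all inThat_plus ts -> inThat_plus (head Leaf ts).
Proof. by case: ts => //= t ts /andP[]. Qed.

Lemma set_root01 t : inThat_plus t -> set_root true (set_root false t) = t.
Proof. by case: t => //= l ts ks /andP[_ /= ->]. Qed.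

Lemma glue_root_inThat_plus t s : inT t -> inT s ->
  inThat_plus (glue_root t s).
Proof.
move=> /degraftP[tP _ _] /degraftP[sP _ _]; rewrite /glue_root.
by case: ifP => _; [exact: last_inThat_plus | exact: head_inThat_plus].
Qed.

Lemma inT_internal t : inT t -> internal t.
Proof. by case/and3P. Qed.

(** The auxiliary product has a leaf as one argument and returns the other one;
    the root label of that subtree is changed to 0 and then back to 1. *)
Lemma raw_diamond_glue (R : comPzRingType) t s : inT t -> inT s ->
  leaf_joined t s -> raw_diamond R t s = basis R (glue t s).
Proof.
move=> tT sT; rewrite raw_diamondE ?inT_internal // /leaf_joined /glue /glue_root.
have [tP _ _] := degraftP tT; have [sP _ _] := degraftP sT.
have lastP := last_inThat_plus tP; have headP := head_inThat_plus sP.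
case: (degraft t) (degraft s) lastP headP => [ts ks] [ss js] /=.
move: (last Leaf ts) (head Leaf ss) => y h yP hP.
case: ifPn => [_ /= hleaf|yleaf _].
  have -> : h = Leaf by case: h hleaf {hP}.
  by rewrite raw_star_leafr /raw_beta !lin_ext_basis (set_root01 yP).
have -> : y = Leaf by case: y yleaf {yP}.
by rewrite raw_star_leafl /raw_beta !lin_ext_basis (set_root01 hP).
Qed.

Lemma tree_word_glue t s : inT t -> inT s -> leaf_joined t s ->
  tree_word (glue t s) = tree_word t ++ tree_word s.
Proof.
move=> tT sT joined; have rootP := glue_root_inThat_plus tT sT.
have [tP szt _] := degraftP tT; have [sP szs _] := degraftP sT.
rewrite /glue tree_word_graft; first last.
- rewrite all_cat /= rootP; apply/and3P; split=> //.
    by apply/allP => y /mem_take /(allP tP).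
  by apply/allP => y /mem_behead /(allP sP).
- by rewrite !size_cat size_take /= size_behead ltn_predL szt szs /= !addnS.
move: joined; rewrite /tree_word /leaf_joined /glue_root {rootP tP sP}.
case: (degraft t) (degraft s) szt szs => [ts ks] [[|s1 ss] js] //= szt _.
case/lastP: ts szt => // ts t1; rewrite size_rcons last_rcons /= => -[szt] joined.
rewrite -[in take _ _]cats1 take_size_cat //; apply: alternating_seq_cat => //.
by case: t1 joined => //= l us qs; case: s1 => //= _; rewrite addn0.
Qed.

(** * Generation of the trees *)

Lemma merge_leaves_id i ks ts : size ts = (size ks).+1 ->
  all internal (take (size ks) ts) -> merge_leaves i ks ts = (i :: ks, ts).
Proof.
elim: ks i ts => [|j ks IH] i [|t ts] //= [szts] /andP[].
by case: t => // l us js _ ints; rewrite IH.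
Qed.

Lemma graft_id t ts i ks : size ts = (size ks).+1 ->
  all internal (take (size ks) ts) ->
  graft (t :: ts) (i :: ks) = Node false (t :: ts) (i :: ks).
Proof. by case: ts => // t' ts szts ints; rewrite /graft merge_leaves_id. Qed.

(** The angle degree is the induction measure because it does not see the root
    label, while a count of internal nodes would not decrease when only a leaf on the
    left is split off.  The splitting leaves or inserts a leaf at the joint, so
    [leaf_joined] always holds; no angles merge except in building the trees
    with two leaves, since the inner subtrees are not leaves. *)
Lemma dtree_glue_ind (P : dtree -> Prop) :
  P Y -> (forall t, P t -> P (dtree_beta t)) ->
  (forall t s u : dtree, leaf_joined t s -> val u = glue t s ->
     P t -> P s -> P u) ->
  forall t, P t.
Proof.
move=> PY Pbeta Pglue t; have [n] := ubnP (deg_angle t).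
elim: n t => // n IH.
suff label0 (t : dtree) : ~~ root_label t -> (deg_angle t < n.+1)%N -> P t.
  move=> t degt; have [lt|lt] := boolP (root_label t); last exact: label0.
  have -> : t = dtree_beta (DTree (inT_set_root false (valP t))).
    by apply: val_inj; case: t lt {degt} => -[|[]].
  by apply: Pbeta; apply: label0; case: t {lt} degt => -[].
case: t => -[//|[] //= ts ks] tT _; rewrite ltnS => degt.
have /and3P[_ /= /and5P[sz2 /eqP szt kpos ints shts] labts] := tT.
case: ts ks => [//|t1 [//|t2 ts]] [//|i ks] /=
  in tT sz2 szt kpos ints shts labts degt *.
case/andP: kpos => i0 ks0.
case/and3P: shts => sh1 sh2 shts; case/and3P: labts => lab1 lab2 labts.
case: szt => {sz2} szt.
rewrite /middle /= subSS subn1 /= in ints.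
have graftE t' :
    graft [:: t', t2 & ts] (i :: ks) = Node false [:: t', t2 & ts] (i :: ks).
  by apply: graft_id; rewrite /= ?szt // -szt.
case: t1 => [|l1 us1 js1] in tT sh1 lab1 degt *; last first.
  (* Split off [t1], leaving a leaf in its place.  De-grafting does not open
     [t1] because its root has label 1. *)
  have t1T : inT (Node l1 us1 js1) by move: lab1; rewrite /inT sh1 /= => /andP[].
  have sT : inT (Node false [:: Leaf, t2 & ts] (i :: ks)).
    apply/and3P; split; rewrite //= ?lab2 //.
    by rewrite szt i0 ks0 sh2 /middle /= subSS subn1 ints eqxx.
  case: l1 => // in tT sh1 lab1 degt t1T *.
  have deg1 := deg_angle_gt0 t1T.
  apply: (Pglue (DTree t1T) (DTree sT)) => [//|||].
  - exact: esym (graftE _).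
  - by apply: IH; move: degt => /=; lia.
  - by apply: IH; move: degt deg1 => /=; lia.
have YT k : (0 < k)%N -> inT (Node false [:: Leaf; Leaf] [:: k]).
  by move=> k0; rewrite /inT /= k0.
case: t2 => [|l2 us2 js2] in tT sh2 lab2 ints graftE degt *.
  (* A second subtree which is a leaf must be the last one, so that the tree
     has two leaves and the single angle [i]; [Y] takes off one unit of it. *)
  case: ts ks => [|//] [|//] in tT szt ints ks0 shts labts graftE degt *.
  case: i => [//|[|i]] in tT i0 graftE degt *.
    by rewrite (_ : DTree tT = Y) //; apply: val_inj.
  apply: (Pglue Y (DTree (YT i.+1 isT))) => //.
  by apply: IH; move: degt => /=; lia.
have t2T : inT (Node l2 us2 js2) by move: lab2; rewrite /inT sh2 /= => /andP[].
case: l2 => // in tT sh2 lab2 ints graftE degt t2T *.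
have deg2 := deg_angle_gt0 t2T.
(* The leaf on the left and the angle next to it form the left factor. *)
have PYi : P (DTree (YT i i0)).
  by apply: IH; move: degt deg2 => /=; lia.
case: ts ks => [|t3 ts] [|k ks] //= in tT szt ints ks0 shts labts graftE degt *.
  (* The right factor is [t2] itself: a root with one child is not a tree. *)
  apply: (Pglue _ (DTree t2T) _ _ _ PYi) => //=.
  by apply: IH; move: degt => /=; lia.
have sT : inT (Node false [:: Node true us2 js2, t3 & ts] (k :: ks)).
  case: szt => szt.
  move: sh2 lab2; rewrite /inT /= /middle /= subSS subn1 => -> ->.
  by rewrite szt eqxx ks0 -szt ints labts shts.
apply: (Pglue _ (DTree sT) _ _ _ PYi) => //=.
  exact: esym (graftE _).
by apply: IH; move: degt => /=; lia.
Qed.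

Theorem lemma4p2 (R : comPzRingType) (pi : {linear B R -> Minf R})
    (pi_morphism : baxter_morphism (@diamond R) (@betaB R)
                                   (@mulM R) (@betaM R) pi)
    (pi_Y : pi (basis R Y) = gen0 R)
    (t : dtree) :
  pi (basis R t) =
    if root_label t then @mono R (nseq (deg_angle t) x1) (dtree_deg_neq0 t)
    else @mono R (alternating_seq (children t) (angles t))
               (dtree_alternating_neq0 t).
Proof.
have [piM pi_beta] := pi_morphism.
have -> : pi (basis R t) = basis R (dtree_word t).
  elim/dtree_glue_ind: t => [|t IH|t s u joined uE IHt IHs].
  - by rewrite pi_Y; congr basis; apply: val_inj.
  - have -> : basis R (dtree_beta t) = betaB (basis R t).
      by rewrite /betaB lin_ext_basis.
    rewrite pi_beta IH /betaM lin_ext_basis; congr basis; apply: val_inj.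
    by rewrite /= tree_word_set_root1 ?(valP t).
  have -> : basis R u = diamond (basis R t) (basis R s).
    rewrite /diamond bilin_ext_basis /diamond_basis.
    rewrite raw_diamond_glue ?(valP t) ?(valP s) //.
    by rewrite -uE /restrict lin_ext_basis valK.
  rewrite piM IHt IHs /mulM bilin_ext_basis; congr basis; apply: val_inj.
  by rewrite /= [val u]uE tree_word_glue ?(valP t) ?(valP s).
case: ifPn => lt; congr basis; apply: val_inj => /=.
  exact: tree_word_label1.
by apply: tree_word_label0 => //; apply: inT_internal; apply: valP.
Qed.
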